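(* Let $X=\mathbb{N}=\{1,2,3,\dots\}$ and define $d:X\times X\to\mathbb{R}$ by $d(x,y)=1+\left|\frac{1}{x}-\frac{1}{y}\right|$ if $x\neq y$ and $d(x,y)=0$ if $x=y$. Define $T:X\to X$ by $Tx=3x$ for all $x\in X$. Then $(X,d)$ is a complete, non-compact metric space, $T$ is continuous, $$d(Tx,Ty)<\frac{1}{2}\{d(x,Tx)+d(y,Ty)\}$$ for all $x,y\in X$ with $x\neq y$, and $T$ has no fixed point. In particular, there exist a complete non-compact metric space and a continuous fixed point free self-mapping of it satisfying this inequality for all pairs of distinct points. *)

(* Defs.v *)
From HB Require Import structures.
From mathcomp Require Import all_boot all_order all_algebra.
From mathcomp Require Import all_classical all_reals all_analysis.

Set Implicit Arguments.
Unset Strict Implicit.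
Unset Printing Implicit Defensive.

Import Order.TTheory GRing.Theory Num.Theory.

Local Open Scope classical_set_scope.
Local Open Scope ring_scope.

(* Nonnegativity of d follows from these axioms, as in the isMetric factory. *)
Record is_metric (R : realType) (X : Type) (d : X -> X -> R) : Prop := IsMetric {
  distxx : forall x, d x x = 0 ;
  dist_positivity : forall x y, d x y = 0 -> x = y ;
  dist_sym : forall x y, d x y = d y x ;
  dist_triangle : forall y x z, d x z <= d x y + d y z
}.

(* The carrier X, with the metric (and its topology and uniformity) given by d. *)
Definition metric_space (R : realType) (X : choiceType) (d : X -> X -> R)
  (dP : is_metric d) : Type := X.

HB.instance Definition _ (R : realType) (X : choiceType) (d : X -> X -> R)
  (dP : is_metric d) := Choice.on (metric_space dP).
HB.instance Definition _ (R : realType) (X : choiceType) (d : X -> X -> R)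
    (dP : is_metric d) :=
  @isMetric.Build R (metric_space dP) d
    (distxx dP) (dist_positivity dP) (dist_sym dP) (dist_triangle dP).

(* This is the axiom of completeType, which the library only provides on
   pointed types. *)
Definition complete (M : uniformType) : Prop :=
  forall F : set_system M, ProperFilter F -> cauchy F -> exists x : M, F --> x.

(* A new type rather than a sigma type over nat, so that no topology is
   inherited from nat. *)
Record posnat : Type := PosNat { posnat_val :> nat; _ : (0 < posnat_val)%N }.

HB.instance Definition _ := [isSub for posnat_val].
HB.instance Definition _ := [Choice of posnat by <:].

Definition d (R : realType) (x y : posnat) : R :=
  if x == y then 0 else 1 + `|(x : nat)%:R^-1 - (y : nat)%:R^-1|.

Lemma triple_gt0 (x : posnat) : (0 < 3 * x)%N.
Proof. by case: x => n n_gt0 /=; rewrite muln_gt0. Qed.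

Definition T (x : posnat) : posnat := PosNat (triple_gt0 x).

(* Main.v *)
Require Import Defs.
From HB Require Import structures.
From mathcomp Require Import all_boot all_order all_algebra.
From mathcomp Require Import all_classical all_reals all_analysis.
From mathcomp Require Import lra.

Import Order.TTheory GRing.Theory Num.Theory.

Local Open Scope classical_set_scope.
Local Open Scope ring_scope.

(** Distinct points of (X, d) are at distance at least 1, so X is uniformly
    discrete: Cauchy filters contain a singleton, every self-map is continuous,
    and X, being infinite, is not compact. With a = 1/x and b = 1/y, the
    contractive inequality reads 1 + |a - b| / 3 < 1 + (a + b) / 3, which holds
    because a and b are positive. *)

Definition uniformly_discrete {R : realType} (M : metricType R) (r : R) :=
  0 < r /\ forall x y : M, x <> y -> r <= mdist x y.

(** Balls are defined by a strict inequality, so the radius [r] itself already isolates [x]. *)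
Lemma uniformly_discrete_ball (R : realType) (M : metricType R) (r : R) (x : M) :
  uniformly_discrete M r -> ball x r `<=` [set x].
Proof.
move=> [_ sepM] y; rewrite ballEmdist/= => xyr.
apply: contrapT => /nesym/sepM; lra.
Qed.

Lemma uniformly_discrete_nbhs (R : realType) (M : metricType R) (r : R) (x : M) :
  uniformly_discrete M r -> nbhs x [set x].
Proof.
move=> sepM; apply/nbhs_ballP; exists r; first by case: sepM.
exact: uniformly_discrete_ball.
Qed.

Lemma uniformly_discrete_complete (R : realType) (M : metricType R) (r : R) :
  uniformly_discrete M r -> complete M.
Proof.
move=> sepM F FF /cauchyP Fcauchy; have [r_gt0 _] := sepM.
(* The limit is the centre of a ball of radius [r] lying in [F]: that ball is contained in
   [[set x]], hence in every neighbourhood of [x]. *)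
have [x Fx] := Fcauchy r r_gt0; exists x => A /nbhs_singleton Ax.
apply: filterS Fx => y /(uniformly_discrete_ball _ _ _ _ sepM) ->.
exact: Ax.
Qed.

Lemma uniformly_discrete_continuous (R : realType) (M : metricType R) (r : R)
    (N : topologicalType) (f : M -> N) :
  uniformly_discrete M r -> continuous f.
Proof.
move=> sepM x A /nbhs_singleton Afx.
apply: filterS (uniformly_discrete_nbhs _ _ _ x sepM) => y ->.
exact: Afx.
Qed.

(** The sequence [u] has no cluster point: by injectivity it meets any [p] at most once, so it
    eventually stays out of the neighbourhood [[set p]]. *)
Lemma uniformly_discrete_not_compact (R : realType) (M : metricType R) (r : R)
    (u : nat -> M) :
  uniformly_discrete M r -> injective u -> ~ compact [set: M].
Proof.
move=> sepM u_inj cptM.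
have [|p [_ clp]] := cptM (u @ \oo) _; first exact: filterT.
have evNp : (u @ \oo) (~` [set p]).
  have [[k ukp]|unp] := pselect (exists k, u k = p).
    exists k.+1 => //= n /= ltkn; rewrite -ukp => /u_inj nk.
    by rewrite nk ltnn in ltkn.
  by exists 0%N => //= n _ unEp; apply: unp; exists n.
by have [q [/=]] := clp _ _ evNp (uniformly_discrete_nbhs _ _ _ p sepM).
Qed.

Lemma d_neq (R : realType) (x y : posnat) : x <> y ->
  d R x y = 1 + `|(x : nat)%:R^-1 - (y : nat)%:R^-1|.
Proof. by rewrite /d; case: eqP. Qed.

Lemma posnat_inv_gt0 (R : realType) (x : posnat) : 0 < (x : nat)%:R^-1 :> R.
Proof. by case: x => n n_gt0 /=; rewrite invr_gt0 ltr0n. Qed.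

Lemma d_is_metric (R : realType) : is_metric (d R).
Proof.
have dxx x : d R x x = 0 by rewrite /d eqxx.
split=> //.
- move=> x y; have [->//|/eqP xy] := eqVneq x y; rewrite d_neq// => /eqP.
  by rewrite gt_eqF// ltr_wpDr.
- by move=> x y; rewrite /d eq_sym distrC.
- move=> y x z.
  (* Needed for the case [x = z], where the left side vanishes. For three distinct points, the spare
     1 on the right only helps. *)
  have d_ge0 a b : 0 <= d R a b by rewrite /d; case: ifP => // _; lra.
  have [->|/eqP xy] := eqVneq x y; first by rewrite dxx add0r.
  have [->|/eqP yz] := eqVneq y z; first by rewrite dxx addr0.
  have [->|/eqP xz] := eqVneq x z; first by rewrite dxx addr_ge0.
  rewrite !d_neq//.
  have := ler_distD ((y : nat)%:R^-1 : R) (x : nat)%:R^-1 (z : nat)%:R^-1.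
  lra.
Qed.

Lemma T_inj : injective T.
Proof.
move=> x y /(congr1 posnat_val)/= /eqP.
by rewrite eqn_pmul2l// => /eqP /val_inj.
Qed.

(** Cancelling [n] in [3 * n = 1 * n] is legitimate because 0 is excluded from the carrier. *)
Lemma T_neq (x : posnat) : T x <> x.
Proof.
case: x => n n_gt0 /(congr1 posnat_val)/= /eqP.
by rewrite -[X in _ == X]mul1n eqn_pmul2r.
Qed.

Lemma d_T_lt (R : realType) (x y : posnat) : x <> y ->
  d R (T x) (T y) < 1 / 2 * (d R x (T x) + d R y (T y)).
Proof.
move=> xy; have Txy : T x <> T y by move/T_inj.
have TV z : ((T z : nat)%:R^-1 : R) = (z : nat)%:R^-1 / 3.
  by rewrite /= natrM invfM mulrC.
rewrite !d_neq// ?TV; try exact/nesym/T_neq.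
have := posnat_inv_gt0 R y; have := posnat_inv_gt0 R x.
set a := (x : nat)%:R^-1; set b := (y : nat)%:R^-1 => a0 b0.
rewrite -mulrBl normrM (ger0_norm (_ : 0 <= 3^-1 :> R))//.
rewrite (ger0_norm (_ : 0 <= a - a / 3)); last by lra.
rewrite (ger0_norm (_ : 0 <= b - b / 3)); last by lra.
(* The source of strictness: the lower bound [- (a + b) < a - b] uses [0 < a], the upper one uses
   [0 < b]. *)
have : `|a - b| < a + b by rewrite ltr_norml; apply/andP; split; lra.
lra.
Qed.

Theorem mainTheorem4 (R : realType) :
  (exists dP : is_metric (d R),
     let X : metricType R := metric_space dP in
     [/\ complete X,
         ~ compact [set: X],
         continuous (T : X -> X),
         forall x y : posnat, x <> y ->
           d R (T x) (T y) < 1 / 2 * (d R x (T x) + d R y (T y)) &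
         ~ exists x : posnat, T x = x])
  /\
  (exists (M : metricType R) (f : M -> M),
     [/\ complete M,
         ~ compact [set: M],
         continuous f,
         ~ exists x : M, f x = x &
         forall x y : M, x <> y ->
           mdist (f x) (f y) < 1 / 2 * (mdist x (f x) + mdist y (f y))]).
Proof.
pose X : metricType R := metric_space (d_is_metric R).
have sepX : uniformly_discrete X 1.
  split=> // x y xy.
  (* [mdist] on [X] is [d R] by conversion, so [d_neq] can rewrite it. *)
  by rewrite [mdist x y](d_neq R x y xy) lerDl normr_ge0.
have Xcomplete : complete X := uniformly_discrete_complete _ _ _ sepX.
have X_not_compact : ~ compact [set: X].
  apply: (uniformly_discrete_not_compact _ _ _
    (* The sequence 1, 2, 3, ..., shifted by one since [nat] starts at 0. *)
    ((fun n => PosNat (ltn0Sn n)) : nat -> X) sepX).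
  by move=> m n [].
have T_continuous : continuous (T : X -> X).
  exact: uniformly_discrete_continuous sepX.
have T_fixfree : ~ exists x : posnat, T x = x by move=> [x /T_neq].
split.
  by exists (d_is_metric R); split=> // x y; exact: d_T_lt.
by exists X, (T : X -> X); split=> // x y; exact: d_T_lt.
Qed.
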